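(* Let $n\geq 3$ and $\ell_1,\ldots,\ell_n\in\mathbb{R}_{>0}$. There exists a spherical cyclic polygon with $n$ sides of lengths $\ell_1,\ldots,\ell_n$ (in this cyclic order) if and only if $$\ell_k<\sum_{\substack{i=1\\ i\neq k}}^{n}\ell_i\quad\text{for all }k\in\{1,\ldots,n\},\qquad\text{and}\qquad \sum_{i=1}^{n}\ell_i<2\pi,$$ and in this case the spherical cyclic polygon is unique (up to isometries of the sphere).
   Context: The sphere is the unit sphere $S^2\subset\mathbb{R}^3$ with its intrinsic metric. A spherical cyclic polygon is a convex spherical polygon inscribed in a circle of the sphere that is not a great circle: it is given by $n$ distinct points $p_1,\ldots,p_n\in S^2$ that lie in this cyclic order on a circle in $S^2$ (the intersection of $S^2$ with an affine plane not containing the origin), and its sides are the shortest geodesic arcs between $p_k$ and $p_{k+1}$ (indices modulo $n$), the $k$-th side having length $\ell_k$, the spherical distance between $p_k$ and $p_{k+1}$. Polygons degenerating to great circles (all interior angles equal to $\pi$) are excluded. Two polygons are identified if an isometry of $S^2$ maps one to the other, respecting the labelling of the sides. *)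

(* Defs.v *)
From mathcomp Require Import all_boot all_order all_algebra.
From mathcomp Require Import all_classical all_reals all_analysis.

Set Implicit Arguments.
Unset Strict Implicit.
Unset Printing Implicit Defensive.
Import Order.TTheory GRing.Theory Num.Theory.
Local Open Scope classical_set_scope.
Local Open Scope ring_scope.

Definition dot3 (R : realType) (x y : 'rV[R]_3) : R :=
  \sum_(i < 3) x 0 i * y 0 i.

Definition sphere2 (R : realType) : set 'rV[R]_3 := [set x | dot3 x x = 1].

(* The intrinsic distance: the angle between two unit vectors, in [0, pi]. *)
Definition sdist (R : realType) (x y : 'rV[R]_3) : R := acos (dot3 x y).

(* Only the values of f on the sphere matter. *)
Definition sphere_isometry (R : realType) (f : 'rV[R]_3 -> 'rV[R]_3) : Prop :=
  set_bij (@sphere2 R) (@sphere2 R) f /\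
  forall x y, sphere2 x -> sphere2 y -> sdist (f x) (f y) = sdist x y.

Definition affine_plane (R : realType) (v : 'rV[R]_3) (c : R) : set 'rV[R]_3 :=
  [set x | dot3 v x = c].

Definition small_circle (R : realType) (C : set 'rV[R]_3) : Prop :=
  exists (v : 'rV[R]_3) (c : R),
    [/\ v != 0, ~ affine_plane v c 0 & C = @sphere2 R `&` affine_plane v c].

Definition circle_param (R : realType) (m : 'rV[R]_3) (r : R)
    (e1 e2 : 'rV[R]_3) (t : R) : 'rV[R]_3 :=
  m + (r * cos t) *: e1 + (r * sin t) *: e2.

(* The points p_0, ..., p_(n-1) are met in this order during one turn around
   the circle C. Both directions are covered, since e2 may be replaced by
   - e2. *)
Definition in_cyclic_order (R : realType) (n : nat) (C : set 'rV[R]_3)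
    (p : 'I_n -> 'rV[R]_3) : Prop :=
  exists (m : 'rV[R]_3) (r : R) (e1 e2 : 'rV[R]_3) (theta : 'I_n -> R),
    [/\ [/\ 0 < r, dot3 e1 e1 = 1, dot3 e2 e2 = 1 & dot3 e1 e2 = 0],
        range (circle_param m r e1 e2) = C,
        forall i j : 'I_n, (i < j)%N -> theta i < theta j,
        forall i j : 'I_n, theta j < theta i + 2 * pi
      & forall i : 'I_n, p i = circle_param m r e1 e2 (theta i)].

(* A polygon is given by its vertices: no two points of a small circle are
   antipodal, so consecutive vertices are joined by a unique shortest arc. *)
Definition spherical_cyclic_polygon (R : realType) (n : nat)
    (p : 'I_n -> 'rV[R]_3) : Prop :=
  injective p /\
  exists C : set 'rV[R]_3, small_circle C /\ in_cyclic_order C p.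

(* ordS is the successor modulo n; the length of a shortest arc is the
   distance between its endpoints. *)
Definition side_length (R : realType) (n : nat) (p : 'I_n -> 'rV[R]_3)
    (k : 'I_n) : R := sdist (p k) (p (ordS k)).

(* For n >= 3, vertex k is the only common point of the sides k - 1 and k, so
   an isometry respects the labelling of the sides iff it respects that of the
   vertices. *)
Definition polygon_congruent (R : realType) (n : nat)
    (p q : 'I_n -> 'rV[R]_3) : Prop :=
  exists f : 'rV[R]_3 -> 'rV[R]_3,
    sphere_isometry f /\ forall k : 'I_n, f (p k) = q k.

(* Main.v *)
Require Import Defs.
From mathcomp Require Import all_boot all_order all_algebra.
From mathcomp Require Import all_classical all_reals all_analysis.
From mathcomp Require Import ring lra.

Set Implicit Arguments.
Unset Strict Implicit.
Unset Printing Implicit Defensive.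
Import Order.TTheory GRing.Theory Num.Theory.
Import numFieldNormedType.Exports.
Local Open Scope classical_set_scope.
Local Open Scope ring_scope.

(** Cut a polygon inscribed in a circle of Euclidean radius [r < 1] into the
    triangles formed by the centre of the circle and each side.  If [2 * a k]
    is the central angle over side [k], its chord has length
    [2 * r * sin (a k)], hence [sin (l k / 2) = r * sin (a k)], while going
    once around the circle means that the [a k], which lie in ]0, pi[, add up
    to [pi].  Conversely a radius [r] in ]0, 1[ and such half angles determine
    the polygon up to an isometry.  The theorem thus reduces to this system in
    [r] and [a], for given half sides [lam k = l k / 2].

    Necessity ([half_side_sum_lt_pi] and [half_side_lt_sum]).  The half side
    [half_side r a = asin (r * sin a)] is strictly smaller than [a] and
    strictly subadditive in [a]; the first fact bounds the perimeter.  Since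
    [half_side r] takes the same value at [a k] and at [pi - a k], which is
    the sum of the other half angles, the second one is the polygon
    inequality.

    Uniqueness ([half_angles_unique]).  If two solutions had radii [r < r'],
    the equations [r * sin (a k) = r' * sin (b k)] would say that [b k] or
    [pi - b k] is [half_side (r / r') (a k)].  When no [b k] is obtuse, the
    perimeter bound for the radius [r / r'] contradicts [\sum_k b k = pi]; when
    one is, the polygon inequality does.  So the radii agree, and the sines of
    the half angles then determine the half angles.

    Existence ([half_angles_exist]).  Let [M] index a longest side and take
    [t = a M] as the unknown: it forces [r = sin (lam M) / sin t], and the other
    half angles, which have to be acute, are
    [asin (sin (lam i) * sin t / sin (lam M))].  At [t = lam M] the sum of all
    half angles is [\sum_i lam i < pi]; at [t = pi - lam M] it exceeds [pi] by
    the polygon inequality for [M].  The intermediate value theorem gives a [t]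
    strictly in between, where [sin t > sin (lam M)], so [r < 1].  Since [t] is
    allowed to pass [pi / 2], the circle centre may lie inside or outside the
    polygon without any case distinction. *)

(** * Half sides of chords *)

Section Analytic.
Variable R : realType.
Implicit Types (r a b t : R).

Lemma sin_asin x : -1 <= x <= 1 -> sin (asin x) = x :> R.
Proof. by move=> xB; rewrite asinK // in_itv. Qed.

Lemma asin_sin a : 0 <= a <= pi / 2 -> asin (sin a) = a.
Proof.
move=> /andP[a0 ah]; rewrite sinK // in_itv /= ah andbT.
by apply: le_trans a0; rewrite oppr_le0 divr_ge0 ?pi_ge0.
Qed.

Lemma sin_pi_sub a : sin (pi - a) = sin a.
Proof. by rewrite sinB sinpi cospi mul0r mulN1r sub0r opprK. Qed.

Lemma asin_sin_obtuse a : pi / 2 <= a <= pi -> asin (sin a) = pi - a.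
Proof.
move=> /andP[ha ap]; rewrite -sin_pi_sub asin_sin //; apply/andP; split; lra.
Qed.

Lemma scaled_sin_itv r a : 0 <= r <= 1 -> -1 <= r * sin a <= 1.
Proof.
move=> /andP[r0 r1]; rewrite -ler_norml normrM (ger0_norm r0).
by rewrite mulr_ile1 // sin_max.
Qed.

Lemma asin_ge0 x : 0 <= x <= 1 -> 0 <= asin x :> R.
Proof.
move=> /andP[x0 x1]; have xB : -1 <= x <= 1 by rewrite x1 andbT; lra.
rewrite leNgt; apply/negP => neg.
suff : 0 < sin (- asin x) by rewrite sinN (sin_asin xB); lra.
have := asin_geNpi2 xB; have := pi_gt0 R => *.
by apply: sin_gt0_pi; apply/andP; split; lra.
Qed.

(** Half of the spherical length of a chord that is seen under the angle
    [2 * a] from the centre of a circle of Euclidean radius [r]. *)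
Definition half_side r a : R := asin (r * sin a).

Lemma sin_half_side r a : 0 <= r <= 1 -> sin (half_side r a) = r * sin a.
Proof. by move=> r01; rewrite sin_asin // scaled_sin_itv. Qed.

Lemma half_side_bounds r a : 0 <= r <= 1 -> 0 <= a <= pi ->
  0 <= half_side r a <= pi / 2.
Proof.
move=> r01 aB; have sB := scaled_sin_itv a r01; apply/andP; split.
  apply: asin_ge0; case/andP: sB => _ ->; rewrite andbT mulr_ge0 //.
    by case/andP: r01.
  exact: sin_ge0_pi.
exact: asin_lepi2.
Qed.

Lemma half_side_pi_sub r a : half_side r (pi - a) = half_side r a.
Proof. by rewrite /half_side sin_pi_sub. Qed.

Lemma ltr_sin_acute a b : 0 <= a <= pi / 2 -> 0 <= b <= pi / 2 ->
  (sin a < sin b) = (a < b).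
Proof.
move=> /andP[a0 ah] /andP[b0 bh]; rewrite ltr_sin // in_itv /=;
  have := pi_gt0 R => ?; apply/andP; split; lra.
Qed.

Lemma half_side_lt r a : 0 < r < 1 -> 0 < a < pi -> half_side r a < a.
Proof.
move=> /andP[r0 r1] /andP[a0 ap].
have /andP[g0 gh] : 0 <= half_side r a <= pi / 2 by rewrite half_side_bounds ?ltW.
have [ah|ha] := leP a (pi / 2); last exact: le_lt_trans ha.
rewrite -ltr_sin_acute ?g0 ?gh //; last by rewrite ltW.
rewrite sin_half_side ?ltW //; by rewrite gtr_pMl // sin_gt0_pi // a0.
Qed.

(** Compare sines: the right hand side is obtuse, and then there is nothing to
    prove, or its sine is that of the left hand side, [r * sin (a + b)], with
    [cos a] and [cos b] replaced by the larger cosines of the half sides; they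
    are larger because [r < 1] makes
    [`|cos a| < Num.sqrt (1 - r ^+ 2 * sin a ^+ 2)]. *)
Lemma half_sideD_lt r a b : 0 < r < 1 -> 0 < a -> 0 < b -> a + b <= pi ->
  half_side r (a + b) < half_side r a + half_side r b.
Proof.
move=> /andP[r0 r1] a0 b0 abp; have pi0 := pi_gt0 R.
have r01 : 0 <= r <= 1 by rewrite !ltW.
have sa0 : 0 < sin a by apply: sin_gt0_pi; apply/andP; split; lra.
have sb0 : 0 < sin b by apply: sin_gt0_pi; apply/andP; split; lra.
have /andP[ga0 gah] : 0 <= half_side r a <= pi / 2.
  by apply: half_side_bounds => //; apply/andP; split; lra.
have /andP[gb0 gbh] : 0 <= half_side r b <= pi / 2.
  by apply: half_side_bounds => //; apply/andP; split; lra.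
have /andP[gc0 gch] : 0 <= half_side r (a + b) <= pi / 2.
  by apply: half_side_bounds => //; apply/andP; split; lra.
have sg := sin_half_side _ r01.
have [sum_le|sum_gt] := leP (half_side r a + half_side r b) (pi / 2); last first.
  apply: le_lt_trans sum_gt; exact: gch.
rewrite -ltr_sin_acute ?gc0 ?gch ?addr_ge0 // sinD !sg.
have cosg c : 0 < sin c -> 0 <= half_side r c <= pi / 2 ->
    `|cos c| < cos (half_side r c).
  move=> sc /andP[c0 ch].
  have cg0 : 0 <= cos (half_side r c) by apply: cos_ge0_pihalf; apply/andP; split; lra.
  rewrite -(ltr_pXn2r (n := 2)) ?nnegrE // -normrX ger0_norm ?sqr_ge0 //.
  rewrite !cos2sin2 sg ltrD2l ltrN2 exprMn gtr_pMl ?exprn_gt0 //.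
  by rewrite exprn_ilt1 // ltW.
rewrite sinD mulrDr (_ : r * (cos a * sin b) = cos a * (r * sin b)); last by ring.
rewrite mulrA ltrD // ?ltr_pM2l ?ltr_pM2r ?mulr_gt0 //.
  by apply: le_lt_trans (ler_norm _) (cosg _ _ _) => //; rewrite gb0.
by apply: le_lt_trans (ler_norm _) (cosg _ _ _) => //; rewrite ga0.
Qed.

Lemma half_side0 r : half_side r 0 = 0.
Proof.
by rewrite /half_side sin0 mulr0 -[X in asin X]sin0 asin_sin // lexx divr_ge0
  ?pi_ge0.
Qed.

Lemma half_sideD_le r a b : 0 < r < 1 -> 0 <= a -> 0 <= b -> a + b <= pi ->
  half_side r (a + b) <= half_side r a + half_side r b.
Proof.
move=> r01; rewrite !le0r => /predU1P[->|a0]; first by rewrite half_side0 !add0r.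
move=> /predU1P[->|b0]; first by rewrite half_side0 !addr0.
by move=> abp; exact/ltW/half_sideD_lt.
Qed.

Lemma half_side_sum_le (I : Type) (s : seq I) (P : pred I) (a : I -> R) r :
  0 < r < 1 -> (forall i, 0 <= a i) -> \sum_(i <- s | P i) a i <= pi ->
  half_side r (\sum_(i <- s | P i) a i) <= \sum_(i <- s | P i) half_side r (a i).
Proof.
move=> r01 a0; elim: s => [|i s IHs]; first by rewrite !big_nil half_side0.
rewrite !big_cons; case: ifP => // _ le_pi.
have S0 : 0 <= \sum_(j <- s | P j) a j by exact: sumr_ge0.
apply: le_trans (half_sideD_le r01 (a0 i) S0 le_pi) _.
by rewrite lerD2l IHs // (le_trans _ le_pi) // lerDr.
Qed.

(** For [r = 1] the argument of [asin] reaches [1], where [asin] is only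
    continuous relatively to [-1, 1]; this suffices because [r * sin u] stays in
    that interval for every [u]. *)
Lemma continuous_half_side r : 0 <= r <= 1 -> continuous (half_side r).
Proof.
move=> r01.
have pi0 : - (pi / 2) <= pi / 2 :> R by have := pi_gt0 R; lra.
have := segment_can_le_continuous pi0
  (continuous_subspaceT (@continuous_sin R)) (@sinK R).
rewrite sinN sin_pihalf => /continuousP asin_cont.
apply/continuousP => X /asin_cont /open_subspaceP[V oV VX].
have -> : half_side r @^-1` X = (fun u => r * sin u) @^-1` V.
  have sB u : `[(-1), 1]%classic (r * sin u) by rewrite /= in_itv /= scaled_sin_itv.
  apply/seteqP; split => u /= Xu.
    have : (V `&` `[(-1), 1]%classic) (r * sin u) by rewrite VX.
    by case.
  have : ((@asin R) @^-1` X `&` `[(-1), 1]%classic) (r * sin u) by rewrite -VX.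
  by case.
apply: open_comp => // u _; apply: continuousM; first exact: cvg_cst.
exact: continuous_sin.
Qed.
End Analytic.

(** * Half angles adding up to pi *)

Section HalfAngles.
Variables (R : realType) (I : finType).
Implicit Types (a b lam : I -> R) (r : R).

Definition splits_pi a := (forall i, 0 < a i < pi) /\ \sum_i a i = pi.

Hypothesis card_I : (2 < #|I|)%N.

Lemma other_index (j k : I) : exists i, (i != j) && (i != k).
Proof.
have /card_gt0P[i] : (0 < #|predC (pred2 j k)|)%N.
  rewrite -(ltn_add2l #|pred2 j k|) cardC addn0 card2.
  by apply: leq_ltn_trans card_I; case: (j != k).
by rewrite !inE negb_or => ?; exists i.
Qed.

Lemma sum_pi_sub a k : \sum_i a i = pi -> \sum_(i | i != k) a i = pi - a k.
Proof. by move=> <-; rewrite [X in X - _](bigD1 k) //= addrAC subrr add0r. Qed.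

Lemma pairD_lt_pi a j k : splits_pi a -> j != k -> a j + a k < pi.
Proof.
move=> [a0 <-] jk; have [i /andP[ij ik]] := other_index j k.
rewrite (bigD1 j) //= (bigD1 k) 1?eq_sym //= addrA ltrDl.
rewrite (bigD1 i) ?ij //= ltr_wpDr //; last by case/andP: (a0 i).
by apply: sumr_ge0 => l _; apply/ltW; case/andP: (a0 l).
Qed.

Lemma half_side_sum_lt_pi a r : 0 < r < 1 -> splits_pi a ->
  \sum_i half_side r (a i) < pi.
Proof.
move=> r01 [a0 <-]; have /card_gt0P[k _] : (0 < #|I|)%N by apply: leq_trans card_I.
by apply: ltr_sum => [|i _]; [apply/hasP; exists k | exact: half_side_lt].
Qed.

(** [a k] and [pi - a k] have the same half side, and [pi - a k] is the sum of
    the other half angles, so this is subadditivity.  It is strict because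
    there are at least two other half angles. *)
Lemma half_side_lt_sum a r k : 0 < r < 1 -> splits_pi a ->
  half_side r (a k) < \sum_(i | i != k) half_side r (a i).
Proof.
move=> r01 [a0 sum_a]; have [j /andP[jk _]] := other_index k k.
have a_ge0 i : 0 <= a i by apply: ltW; case/andP: (a0 i).
have [l /andP[lk lj]] := other_index k j.
rewrite -half_side_pi_sub -(sum_pi_sub k sum_a) (bigD1 j) //= [X in _ < X](bigD1 j) //=.
have rest_le : a j + \sum_(i | (i != k) && (i != j)) a i <= pi.
  by rewrite -(bigD1 j jk) sum_pi_sub // lerBlDr lerDl.
have rest_gt0 : 0 < \sum_(i | (i != k) && (i != j)) a i.
  rewrite (bigD1 l) ?lk //= ltr_wpDr //; last by case/andP: (a0 l).
  exact: sumr_ge0.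
apply: lt_le_trans (half_sideD_lt r01 _ rest_gt0 rest_le) _; first by case/andP: (a0 j).
rewrite lerD2l half_side_sum_le //; apply: le_trans rest_le.
by rewrite lerDr.
Qed.

(** If [a k < b k] then [b k = pi - a k].  Any other index [i] with
    [b i <> a i] would also have [b i = pi - a i], so that
    [(a i + a k) + (b i + b k) = 2 * pi] although both pairs sum to less than
    [pi].  Hence [a] and [b] differ at [k] only, which is incompatible with
    equal sums. *)
Lemma half_angles_le_of_sin_eq a b k : splits_pi a -> splits_pi b ->
  (forall i, sin (a i) = sin (b i)) -> b k <= a k.
Proof.
move=> sa sb eq_sin; have [a0 sum_a] := sa; have [b0 sum_b] := sb.
rewrite leNgt; apply/negP => lt_ab.
have eq_or i : b i = a i \/ b i = pi - a i.
  have /andP[? ?] := a0 i; have /andP[? ?] := b0 i.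
  have := congr1 (@asin R) (eq_sin i).
  have acute c : 0 < c -> c <= pi / 2 -> asin (sin c) = c.
    by move=> c0 ch; rewrite asin_sin // ltW.
  have obtuse c : c < pi -> pi / 2 < c -> asin (sin c) = pi - c.
    by move=> cp hc; rewrite asin_sin_obtuse // !ltW.
  have [ai|ai] := leP (a i) (pi / 2); have [bi|bi] := leP (b i) (pi / 2).
  - by rewrite !acute // => ->; left.
  - by rewrite acute // obtuse // => ->; right; ring.
  - by rewrite obtuse // acute // => ->; right.
  - by rewrite !obtuse // => eq_asin; left; lra.
have bk : b k = pi - a k by case: (eq_or k) => // eq_k; rewrite eq_k ltxx in lt_ab.
have ba i : i != k -> b i = a i.
  move=> ik; case: (eq_or i) => // bi; have := pairD_lt_pi sa ik.
  by have := pairD_lt_pi sb ik; lra.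
have := sum_pi_sub k sum_a; rewrite -(eq_bigr _ ba) (sum_pi_sub k sum_b).
lra.
Qed.

(** The necessary conditions, applied to the half angles [a] and the ratio
    [r / r' < 1] in the role of the radius, exclude [r < r']: then
    [half_side (r / r') (a i)] is [b i], or [pi - b i] for the at most one obtuse
    [b i]. *)
Lemma scale_le_of_sin_eq a b r r' : 0 < r -> splits_pi a -> splits_pi b ->
  (forall i, r * sin (a i) = r' * sin (b i)) -> r' <= r.
Proof.
move=> r0 sa sb eq_sin; rewrite leNgt; apply/negP => lt_rr'.
have r'0 : 0 < r' by exact: lt_trans lt_rr'.
have q01 : 0 < r / r' < 1 by rewrite divr_gt0 //= ltr_pdivrMr // mul1r.
have half_b i : half_side (r / r') (a i) = asin (sin (b i)).
  by rewrite /half_side mulrAC eq_sin mulrAC divff ?mul1r // gt_eqF.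
have [b0 sum_b] := sb.
(* At most one b k is obtuse; the two cases contradict the polygon inequality
   and the perimeter bound respectively. *)
have [[k bk]|acute] := pselect (exists k, pi / 2 < b k).
  have := half_side_lt_sum k q01 sa; rewrite half_b asin_sin_obtuse; last first.
    by apply/andP; split; [exact: ltW|case/andP: (b0 k) => _ /ltW].
  rewrite (eq_bigr b) ?sum_pi_sub ?ltxx // => i ik; rewrite half_b asin_sin //.
  have := pairD_lt_pi sb ik; have /andP[? ?] := b0 i => ?.
  by apply/andP; split; lra.
have := half_side_sum_lt_pi q01 sa; rewrite (eq_bigr b) ?sum_b ?ltxx // => i _.
rewrite half_b asin_sin //; have /andP[/ltW -> _] /= := b0 i.
by rewrite leNgt; apply/negP => bi; apply: acute; exists i.
Qed.

Lemma half_angles_unique a b r r' : 0 < r -> 0 < r' ->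
    splits_pi a -> splits_pi b ->
    (forall i, r * sin (a i) = r' * sin (b i)) ->
  r = r' /\ a =1 b.
Proof.
move=> r0 r'0 sa sb eq_sin.
have eq_r : r = r'.
  apply/eqP; rewrite eq_le (scale_le_of_sin_eq r0 sa sb) // andbT.
  by apply: (scale_le_of_sin_eq r'0 sb sa) => i.
split=> // k; have eq_s i : sin (a i) = sin (b i).
  by move: (eq_sin i); rewrite eq_r; apply: mulfI; rewrite gt_eqF.
by apply/eqP; rewrite eq_le !half_angles_le_of_sin_eq.
Qed.

(** Only a longest side can have an obtuse half angle [t], so the other half
    angles are functions of [t]; and its length being maximal keeps the ratios
    [sin (lam i) / sin (lam M)] at most [1], so that these functions are defined
    and continuous for all [t]. *)
Lemma half_angles_exist lam :
    (forall i, 0 < lam i) -> (forall k, lam k < \sum_(i | i != k) lam i) ->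
    \sum_i lam i < pi ->
  exists r a, [/\ 0 < r < 1, splits_pi a
    & forall i, half_side r (a i) = lam i].
Proof.
move=> lam0 tri sum_lam.
have /card_gt0P[i0 _] : (0 < #|I|)%N by apply: leq_trans card_I.
pose M := [arg max_(i > i0) lam i]%O.
have lamM i : lam i <= lam M.
  by rewrite /M; case: Order.TotalTheory.arg_maxP => // j _; apply.
have lam_acute i : lam i < pi / 2.
  have := sum_lam; rewrite (bigD1 i) //=; have := tri i; lra.
have sin_lam0 i : 0 < sin (lam i).
  by apply: sin_gt0_pihalf; rewrite lam0 lam_acute.
pose q i := sin (lam i) / sin (lam M).
have q01 i : 0 <= q i <= 1.
  have sin_ge0 j : 0 <= sin (lam j) by exact: ltW.
  rewrite divr_ge0 //= ler_pdivrMr // mul1r leNgt ltr_sin_acute; last 2 first.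
  - by rewrite !ltW.
  - by rewrite !ltW.
  by rewrite -leNgt.
(* The sum of all half angles, to be made equal to pi. *)
pose H t := t + \sum_(i | i != M) half_side (q i) t.
have halfM i : half_side (q i) (lam M) = lam i.
  by rewrite /half_side /q divfK ?gt_eqF // asin_sin // !ltW.
have H1 : H (lam M) < pi.
  rewrite /H (eq_bigr lam) => [|i _]; last exact: halfM.
  by rewrite -[X in X < _](@bigD1 _ _ _ _ M xpredT lam).
have H2 : pi < H (pi - lam M).
  rewrite /H (eq_bigr lam) => [|i _]; last by rewrite half_side_pi_sub halfM.
  by have := tri M; lra.
have H_cont : continuous H.
  move=> t; apply: cvgD; first exact: cvg_id.
  by apply: cvg_big => // [|i _]; [exact: add_continuous|exact: continuous_half_side].
have [||t] := @IVT R H (lam M) (pi - lam M) pi _ (continuous_subspaceT H_cont).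
- by have := lam_acute M; lra.
- by rewrite ge_min le_max (ltW H1) (ltW H2) orbT.
rewrite in_itv /= => /andP[t_ge t_le] Ht.
have tM : lam M < t.
  by rewrite lt_neqAle t_ge andbT; apply: contraTneq H1 => ->; rewrite Ht ltxx.
have tpM : t < pi - lam M.
  by rewrite lt_neqAle t_le andbT; apply: contraTneq H2 => <-; rewrite Ht ltxx.
have lM0 := lam0 M.
have sint : sin (lam M) < sin t.
  have [th|th] := leP t (pi / 2).
    by rewrite ltr_sin_acute //; apply/andP; split=> //; lra.
  rewrite -(sin_pi_sub t) ltr_sin_acute; first lra.
    by rewrite !ltW.
  by apply/andP; split; lra.
have sint0 : 0 < sin t by exact: lt_trans sint.
pose a i := if i == M then t else half_side (q i) t.
exists (sin (lam M) / sin t), a; split.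
- by rewrite divr_gt0 //= ltr_pdivrMr // mul1r.
- split=> [i|].
    rewrite /a; case: eqP => _; first by apply/andP; split; lra.
    have /andP[g0 gh] : 0 <= half_side (q i) t <= pi / 2.
      by apply: half_side_bounds => //; apply/andP; split; lra.
    rewrite lt0r g0 andbT; apply/andP; split; last by lra.
    have : 0 < q i * sin t by rewrite mulr_gt0 ?divr_gt0.
    by rewrite -(sin_half_side t (q01 i)); apply: contraTneq => ->; rewrite sin0 ltxx.
  rewrite (bigD1 M) //= {1}/a eqxx -[RHS]Ht; congr (_ + _).
  by apply: eq_bigr => i /negPf iM; rewrite /a iM.
- have acute i : 0 <= lam i <= pi / 2 by rewrite !ltW.
  move=> i; rewrite -[RHS]asin_sin // /a; case: eqP => [->|_].
    by rewrite /half_side divfK ?gt_eqF.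
  rewrite {1}/half_side sin_half_side // /q mulrA [_ / _ * _]mulrC -!mulrA; congr asin.
  by field; rewrite !gt_eqF.
Qed.
End HalfAngles.

(** * Orthonormal frames and circles of the sphere *)

Section Frames.
Variable R : realType.
Implicit Types (x y z : 'rV[R]_3) (A B : 'M[R]_3) (r t : R).

Lemma dot3_mulmx x y : dot3 x y = (x *m y^T) 0 0.
Proof. by rewrite mxE; apply: eq_bigr => i _; rewrite mxE. Qed.

Lemma dot3C x y : dot3 x y = dot3 y x.
Proof. by apply: eq_bigr => i _; rewrite mulrC. Qed.

Lemma dot3Dr x y z : dot3 x (y + z) = dot3 x y + dot3 x z.
Proof. by rewrite !dot3_mulmx linearD mulmxDr mxE. Qed.

Lemma dot3Zr a x y : dot3 x (a *: y) = a * dot3 x y.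
Proof. by rewrite !dot3_mulmx linearZ -scalemxAr mxE. Qed.

Lemma dot30 x : dot3 x 0 = 0.
Proof. by rewrite dot3_mulmx trmx0 mulmx0 mxE. Qed.

Lemma dot3Dl x y z : dot3 (x + y) z = dot3 x z + dot3 y z.
Proof. by rewrite dot3C dot3Dr !(dot3C z). Qed.

Lemma dot3Zl a x y : dot3 (a *: x) y = a * dot3 x y.
Proof. by rewrite dot3C dot3Zr (dot3C y). Qed.

Lemma dot3_self_gt0 x : x != 0 -> 0 < dot3 x x.
Proof.
move=> x0; have sq_ge0 (i : 'I_3) : true -> 0 <= x 0 i * x 0 i by rewrite -expr2 sqr_ge0.
rewrite lt0r sumr_ge0 // andbT; apply: contraNneq x0 => /(psumr_eq0P sq_ge0) xi.
apply/eqP/rowP => i; rewrite mxE; apply/eqP; rewrite -sqrf_eq0 expr2.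
exact/eqP/xi.
Qed.

Definition row3 a b c : 'rV[R]_3 := \row_j [:: a; b; c]`_j.

Definition rows3 x y z : 'M[R]_3 := \matrix_j [:: x; y; z]`_j.

Lemma sum_ord3 (V : nmodType) (F : 'I_3 -> V) :
  \sum_i F i = F 0 + F 1 + F (lift ord0 1).
Proof.
rewrite !big_ord_recl big_ord0 addr0 addrA; congr (_ + _ + _); congr F; exact: val_inj.
Qed.

Lemma dot3_row3 a b c a' b' c' :
  dot3 (row3 a b c) (row3 a' b' c') = a * a' + b * b' + c * c'.
Proof. by rewrite /dot3 sum_ord3 !mxE. Qed.

Lemma row3_eta x : x = row3 (x 0 0) (x 0 1) (x 0 (lift ord0 1)).
Proof.
by apply/rowP => -[[|[|[|]]] //= i3]; rewrite mxE /=; congr (x 0 _); exact: val_inj.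
Qed.

Lemma row3_mul_rows3 a b c x y z :
  row3 a b c *m rows3 x y z = a *: x + b *: y + c *: z.
Proof. by apply/rowP => j; rewrite mxE sum_ord3 !mxE. Qed.

Definition orthogonal_mx A := A *m A^T = 1%:M.

Lemma rows3_orthogonal x y z :
    [/\ dot3 x x = 1, dot3 y y = 1 & dot3 z z = 1] ->
    [/\ dot3 x y = 0, dot3 x z = 0 & dot3 y z = 0] ->
  orthogonal_mx (rows3 x y z).
Proof.
move=> [xx yy zz] [xy xz yz]; apply/matrixP => i j.
have -> : (rows3 x y z *m (rows3 x y z)^T) i j =
    dot3 (row i (rows3 x y z)) (row j (rows3 x y z)).
  by rewrite mxE; apply: eq_bigr => k _; rewrite !mxE.
rewrite !rowK mxE.
case: i j => [[|[|[|]]] //= ?] [[|[|[|]]] //= ?]; rewrite ?xx ?yy ?zz //;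
  by rewrite ?xy ?xz ?yz // dot3C ?xy ?xz ?yz.
Qed.

Lemma orthogonal_mxM A B :
  orthogonal_mx A -> orthogonal_mx B -> orthogonal_mx (A *m B).
Proof.
by move=> oA oB; rewrite /orthogonal_mx trmx_mul mulmxA -(mulmxA A) oB mulmx1.
Qed.

Lemma orthogonal_mxT A : orthogonal_mx A -> orthogonal_mx A^T.
Proof. by move=> /mulmx1C; rewrite /orthogonal_mx trmxK. Qed.

Lemma dot3_orthogonal A x y :
  orthogonal_mx A -> dot3 (x *m A) (y *m A) = dot3 x y.
Proof.
by move=> oA; rewrite !dot3_mulmx trmx_mul mulmxA -(mulmxA x) oA mulmx1.
Qed.

Lemma orthogonal_sphere_isometry A :
  orthogonal_mx A -> sphere_isometry (fun x => x *m A).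
Proof.
move=> oA; split=> [|x y _ _]; last by rewrite /sdist dot3_orthogonal.
split=> [x|x y _ _|x] /=.
- by rewrite /sphere2 /= dot3_orthogonal.
- by move/(congr1 (mulmx^~ A^T)); rewrite -!mulmxA oA !mulmx1.
move=> Sx; exists (x *m A^T).
  by rewrite /sphere2 /= dot3_orthogonal //; exact: orthogonal_mxT.
by rewrite -mulmxA (mulmx1C oA) mulmx1.
Qed.

(** The circle of radius [r] on the sphere in the horizontal plane above the
    origin, to which all circles of that radius are moved. *)
Definition std_circle r t : 'rV[R]_3 :=
  row3 (r * cos t) (r * sin t) (Num.sqrt (1 - r ^+ 2)).

Lemma dot3_std_circle r s t : 0 <= r <= 1 ->
  dot3 (std_circle r s) (std_circle r t) = 1 - (r * sin ((s - t) / 2)) ^+ 2 *+ 2.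
Proof.
move=> /andP[r0 r1]; have r2 : 0 <= 1 - r ^+ 2 by rewrite subr_ge0 expr_le1.
rewrite dot3_row3 -(expr2 (Num.sqrt _)) sqr_sqrtr //.
have := cos_mulr2n ((s - t) / 2).
rewrite cos2sin2 (_ : _ / 2 *+ 2 = s - t); last by lra.
rewrite cosB => cos_eq.
transitivity (r ^+ 2 * (cos s * cos t + sin s * sin t) + (1 - r ^+ 2)); first by ring.
by rewrite cos_eq; ring.
Qed.

Definition rotation d : 'M[R]_3 :=
  rows3 (row3 (cos d) (sin d) 0) (row3 (- sin d) (cos d) 0) (row3 0 0 1).

Lemma rotation_orthogonal d : orthogonal_mx (rotation d).
Proof.
have := cos2Dsin2 d => cs; apply: rows3_orthogonal; split; rewrite dot3_row3;
  lra.
Qed.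

Lemma std_circle_rotation r t d :
  std_circle r t *m rotation d = std_circle r (t + d).
Proof.
rewrite row3_mul_rows3 /std_circle cosD sinD; apply/rowP => -[[|[|[|]]] //= i3];
  by rewrite !mxE /=; ring.
Qed.

Lemma unit_pair_polar (x y : R) : x ^+ 2 + y ^+ 2 = 1 -> exists t, x = cos t /\ y = sin t.
Proof.
move=> xy1; have xB : -1 <= x <= 1.
  rewrite -ler_norml -(expr_le1 (n := 2)) // -normrX ger0_norm ?sqr_ge0 //.
  by rewrite -xy1 lerDl sqr_ge0.
have sx : sin (acos x) = `|y| by rewrite sin_acos // -xy1 addrAC subrr add0r sqrtr_sqr.
have cx : cos (acos x) = x by rewrite acosK // in_itv.
have [y0|y0] := leP 0 y; first by exists (acos x); rewrite sx cx ger0_norm.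
by exists (- acos x); rewrite sinN cosN sx cx ltr0_norm // opprK.
Qed.

(** The centre [m] is orthogonal to [e1] and [e2] and has square norm
    [1 - r ^+ 2], as comparing the trigonometric coefficients of
    [dot3 (circle_param m r e1 e2 t) (circle_param m r e1 e2 t) = 1] shows.
    It is nonzero because the plane avoids the origin, so [r < 1] and
    normalizing [m] completes [e1, e2] to an orthonormal frame. *)
Lemma circle_param_std v c m r e1 e2 :
    0 < r -> dot3 e1 e1 = 1 -> dot3 e2 e2 = 1 -> dot3 e1 e2 = 0 ->
    ~ affine_plane v c 0 ->
    range (circle_param m r e1 e2) `<=` @sphere2 R `&` affine_plane v c ->
  exists A, [/\ r < 1, orthogonal_mx A
    & forall t, circle_param m r e1 e2 t = std_circle r t *m A].
Proof.
move=> r0 e11 e22 e12 c0 sub.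
have on_sphere t : dot3 m m + r ^+ 2 +
    (dot3 m e1 * (r * cos t) + dot3 m e2 * (r * sin t)) *+ 2 = 1.
  have [] := sub (circle_param m r e1 e2 t); first by exists t.
  rewrite /sphere2 /= => unit_pt _; rewrite -[RHS]unit_pt /circle_param.
  rewrite !(dot3Dl, dot3Dr, dot3Zl, dot3Zr) e11 e22 e12 !(dot3C _ m) (dot3C e2 e1) e12.
  have -> : r ^+ 2 = (r * cos t) ^+ 2 + (r * sin t) ^+ 2.
    by rewrite !exprMn -mulrDr cos2Dsin2 mulr1.
  by ring.
have on_plane t : dot3 v m + r * cos t * dot3 v e1 + r * sin t * dot3 v e2 = c.
  have [] := sub (circle_param m r e1 e2 t); first by exists t.
  by move=> _; rewrite /affine_plane /= /circle_param !(dot3Dr, dot3Zr).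
have trig_coeff0 (a b d e : R) : (forall t, a + (b * cos t + d * sin t) = e) ->
    [/\ a = e, b = 0 & d = 0].
  move=> eq_e; have := eq_e 0; have := eq_e pi; have := eq_e (pi / 2).
  by rewrite cos0 sin0 cospi sinpi cos_pihalf sin_pihalf => ???; split; lra.
have [mm me1 me2] : [/\ dot3 m m + r ^+ 2 = 1, dot3 m e1 = 0 & dot3 m e2 = 0].
  have [|-> b0 d0] := @trig_coeff0 (dot3 m m + r ^+ 2)
    (dot3 m e1 * r *+ 2) (dot3 m e2 * r *+ 2) 1.
    by move=> t; rewrite -(on_sphere t); ring.
  move/eqP: b0; move/eqP: d0; rewrite !mulrn_eq0 /= !mulf_eq0 (gt_eqF r0) !orbF.
  by move=> /eqP -> /eqP ->.
have [|vm _ _] := @trig_coeff0 (dot3 v m) (r * dot3 v e1) (r * dot3 v e2) c.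
  by move=> t; rewrite -(on_plane t); ring.
have m_neq0 : m != 0.
  apply/eqP => m0; apply: c0; by rewrite /affine_plane /= -vm m0.
have mm0 := dot3_self_gt0 m_neq0.
have r1 : r < 1 by rewrite -(expr_lt1 (n := 2)) ?ltW // -mm ltrDr.
pose h := Num.sqrt (1 - r ^+ 2).
have hh : h ^+ 2 = dot3 m m by rewrite sqr_sqrtr -mm addrK // ltW.
have h0 : 0 < h by rewrite sqrtr_gt0 -mm addrK.
exists (rows3 e1 e2 (h^-1 *: m)); split=> // [|t].
  apply: rows3_orthogonal; split; rewrite ?(dot3Zl, dot3Zr) //.
  - by rewrite -hh; field; rewrite gt_eqF.
  - by rewrite dot3C me1 mulr0.
  - by rewrite dot3C me2 mulr0.
rewrite row3_mul_rows3 /circle_param scalerA divff ?gt_eqF // scale1r.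
by rewrite [RHS]addrC addrA.
Qed.

Lemma std_circle_range r : 0 < r < 1 ->
  exists v m e1 e2 c, [/\ v != 0, ~ affine_plane v c 0,
    [/\ dot3 e1 e1 = 1, dot3 e2 e2 = 1 & dot3 e1 e2 = 0],
    circle_param m r e1 e2 =1 std_circle r
    & range (circle_param m r e1 e2) = @sphere2 R `&` affine_plane v c].
Proof.
move=> /andP[r0 r1]; set h := Num.sqrt (1 - r ^+ 2).
have h2 : h ^+ 2 = 1 - r ^+ 2 by rewrite sqr_sqrtr // subr_ge0 expr_le1 // ltW.
have h0 : 0 < h by rewrite sqrtr_gt0 subr_gt0 expr_lt1 // ltW.
have std : circle_param (row3 0 0 h) r (row3 1 0 0) (row3 0 1 0) =1 std_circle r.
  by move=> t; apply/rowP => -[[|[|[|]]] //= i3]; rewrite !mxE /= -?/h; ring.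
exists (row3 0 0 1), (row3 0 0 h), (row3 1 0 0), (row3 0 1 0), h.
split=> //.
- apply/eqP => /rowP /(_ (lift ord0 1)); rewrite !mxE /= => /eqP.
  by rewrite oner_eq0.
- by rewrite /affine_plane /= dot30 => /esym/eqP; rewrite gt_eqF.
- by split; rewrite dot3_row3; ring.
apply/seteqP; split=> [_ [t _ <-]|x].
  rewrite std /sphere2 /affine_plane /= !dot3_row3; split; last by rewrite -/h; ring.
  have := cos2Dsin2 t; rewrite -/h -[RHS]/1 -(expr2 h) h2 => cs.
  transitivity (r ^+ 2 * (cos t ^+ 2 + sin t ^+ 2) + (1 - r ^+ 2)); first by ring.
  by rewrite cs; ring.
rewrite (row3_eta x) /sphere2 /affine_plane /= !dot3_row3.
set a := x _ _; set b := x _ _; set d := x _ _ => -[sph].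
rewrite !mul0r !add0r mul1r => dh.
have [|t [ct st]] := @unit_pair_polar (a / r) (b / r).
  have -> : (a / r) ^+ 2 + (b / r) ^+ 2 = (a * a + b * b) / r ^+ 2.
    by field; rewrite gt_eqF.
  rewrite (_ : _ + _ = r ^+ 2) ?divff ?expf_neq0 ?gt_eqF //.
  by move: sph; rewrite dh -(expr2 h) h2; lra.
exists t => //; rewrite std /std_circle -ct -st -/h dh.
by rewrite !(mulrC r) !divfK ?gt_eqF.
Qed.
End Frames.

(** * Polygons and their half central angles *)

Section Polygons.
Variables (R : realType) (n : nat).
Implicit Types (p q : 'I_n -> 'rV[R]_3) (theta a : 'I_n -> R) (r : R).

Definition one_turn theta :=
  (forall i j : 'I_n, (i < j)%N -> theta i < theta j) /\
  (forall i j : 'I_n, theta j < theta i + 2 * pi).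

(** The correction by [pi] accounts for the full turn between the last vertex
    and the first. *)
Definition half_gap theta (k : 'I_n) : R :=
  (theta (ordS k) - theta k) / 2 + (if k.+1 == n then pi else 0).

Lemma val_ordS_lt (k : 'I_n) : (k.+1 < n)%N -> ordS k = k.+1 :> nat.
Proof. by move=> kn; rewrite /= modn_small. Qed.

Lemma val_ordS_last (k : 'I_n) : k.+1 = n -> ordS k = 0%N :> nat.
Proof. by move=> kn; rewrite /= kn modnn. Qed.

(** The differences [theta (ordS k) - theta k] cancel because [ordS] permutes
    the indices; only the correction at the last index remains. *)
Lemma half_gap_splits_pi theta : (1 < n)%N -> one_turn theta ->
  splits_pi (half_gap theta).
Proof.
move=> n1 [incr wrap]; split=> [k|].
  rewrite /half_gap; case: eqP => kn.
    have lt_k : (ordS k < k)%N by rewrite val_ordS_last // -ltnS kn.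
    have := incr _ _ lt_k; have := wrap (ordS k) k => ? ?.
    by apply/andP; split; lra.
  have lt_k : (k < ordS k)%N.
    by rewrite val_ordS_lt // ltn_neqAle ltn_ord andbT; apply/eqP.
  have := incr _ _ lt_k; have := wrap k (ordS k) => ? ?.
  by apply/andP; split; lra.
have n0 : (n.-1 < n)%N by rewrite ltn_predL (ltn_trans _ n1).
have sum_ordS : \sum_k theta (ordS k) = \sum_k theta k.
  by rewrite [RHS](reindex_inj (@ordS_inj n)).
rewrite big_split /= -mulr_suml sumrB sum_ordS subrr mul0r add0r.
rewrite -big_mkcond (big_pred1 (Ordinal n0)) // => k /=.
by rewrite -val_eqE /= -[in RHS]eqSS prednK // (ltn_trans _ n1).
Qed.

Lemma half_gap_eq_shift theta theta' : (0 < n)%N ->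
    half_gap theta =1 half_gap theta' ->
  exists d, forall k, theta' k = theta k + d.
Proof.
move=> n0 eq_gap; exists (theta' (Ordinal n0) - theta (Ordinal n0)) => -[k].
elim: k => [|k IHk] kn.
  by have -> : Ordinal kn = Ordinal n0; [exact: val_inj | rewrite addrC subrK].
have k_lt : (k < n)%N by exact: ltnW.
have := eq_gap (Ordinal k_lt); have := IHk k_lt.
rewrite /half_gap; have -> : ordS (Ordinal k_lt) = Ordinal kn.
  exact/val_inj/val_ordS_lt.
have -> : ((Ordinal k_lt).+1 == n) = false by rewrite /= ltn_eqF.
move: (theta _) (theta _) (theta _) (theta' _) (theta' _) (theta' _) => x0 x1 x2 y0 y1 y2.
lra.
Qed.

(** The inverse of [half_gap], normalized by [theta 0 = 0]. *)
Definition partial_turn a (k : 'I_n) : R := 2 * \sum_(i < n | (i < k)%N) a i.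

Lemma partial_turn_one_turn a : splits_pi a -> one_turn (partial_turn a).
Proof.
move=> [a0 sum_a]; have a_ge0 i : 0 <= a i by apply: ltW; case/andP: (a0 i).
split=> i j.
  move=> ij; rewrite /partial_turn ltr_pM2l //.
  rewrite [X in _ < X](bigID (fun l : 'I_n => (l < i)%N)) /=.
  rewrite (eq_bigl (fun l : 'I_n => (l < j)%N && (l < i)%N)); last first.
    by move=> l /=; case: ltnP => li; rewrite ?andbF // (ltn_trans li ij).
  rewrite ltrDl (bigD1 i) /= ?ij ?ltnn //.
  by rewrite ltr_wpDr ?sumr_ge0 //; case/andP: (a0 i).
rewrite /partial_turn -mulrDr ltr_pM2l //.
apply: (@lt_le_trans _ _ pi); last by rewrite lerDr sumr_ge0.
rewrite -sum_a [X in _ < X](bigID (fun l : 'I_n => (l < j)%N)) /= ltrDl.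
rewrite (bigD1 j) /= ?ltnn // ltr_wpDr ?sumr_ge0 //; by case/andP: (a0 j).
Qed.

Lemma half_gap_partial_turn a : splits_pi a -> half_gap (partial_turn a) =1 a.
Proof.
move=> [_ sum_a] k; rewrite /half_gap /partial_turn.
set S := \sum_(i < n | (i < k)%N) a i.
case: eqP => kn.
  rewrite val_ordS_last // big_pred0 // -sum_a (bigD1 k) //=.
  have -> : \sum_(i < n | i != k) a i = S; last by lra.
  by apply: eq_bigl => i; rewrite ltn_neqAle -ltnS kn ltn_ord andbT.
rewrite val_ordS_lt; last by rewrite ltn_neqAle ltn_ord andbT; apply/eqP.
rewrite (bigD1 k) //=.
have -> : \sum_(i < n | (i < k.+1)%N && (i != k)) a i = S; last by lra.
by apply: eq_bigl => i; rewrite ltnS [RHS]ltn_neqAle andbC.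
Qed.

Lemma acos_chord (x : R) : 0 <= x <= 1 -> acos (1 - x ^+ 2 *+ 2) = 2 * asin x.
Proof.
move=> x01; have x0 := asin_ge0 x01; case/andP: x01 => x_ge0 x_le1.
have xB : -1 <= x <= 1 by apply/andP; split; lra.
have xh := asin_lepi2 xB.
rewrite -[RHS]cosK; last by rewrite in_itv /=; apply/andP; split; lra.
by rewrite mulrC mulr_natr cos_mulr2n cos2sin2 sin_asin //; congr acos; ring.
Qed.

(** The correction by [pi] in [half_gap] only changes the sign of the sine, and
    the chord depends on its square. *)
Lemma side_length_std A r theta p k : 0 <= r <= 1 -> orthogonal_mx A ->
    0 <= half_gap theta k <= pi ->
    (forall i, p i = std_circle r (theta i) *m A) ->
  side_length p k = 2 * half_side r (half_gap theta k).
Proof.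
move=> r01 oA gB pE; rewrite /side_length /sdist !pE dot3_orthogonal //.
rewrite dot3_std_circle // /half_side -acos_chord; last first.
  rewrite mulr_ge0 ?sin_ge0_pi //=; last by case/andP: r01.
  by case/andP: (scaled_sin_itv (half_gap theta k) r01).
rewrite !exprMn; congr (acos (1 - (_ * _) *+ 2)).
rewrite /half_gap; set d := theta k - _.
rewrite (_ : (theta (ordS k) - theta k) / 2 = - (d / 2)); last by rewrite /d; lra.
by case: eqP => _; rewrite ?sinDpi ?addr0 sinN ?opprK ?sqrrN.
Qed.

Lemma polygon_std p : (1 < n)%N -> spherical_cyclic_polygon p ->
  exists r A theta, [/\ 0 < r < 1, orthogonal_mx A, one_turn theta,
    forall i, p i = std_circle r (theta i) *m A
    & forall k, side_length p k = 2 * half_side r (half_gap theta k)].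
Proof.
move=> n1 [_ [C [[v [c [_ c0 ->]]] [m [r [e1 [e2 [theta]]]]]]]].
case=> -[r0 e11 e22 e12] rangeC incr wrap pE.
have [|A [r1 oA stdE]] := circle_param_std r0 e11 e22 e12 c0 (m := m).
  by rewrite rangeC.
have pE' i : p i = std_circle r (theta i) *m A by rewrite pE stdE.
have turn : one_turn theta by [].
exists r, A, theta; split=> // [|k]; first by rewrite r0.
apply: (side_length_std _ oA) => //; first by rewrite !ltW.
by case: (half_gap_splits_pi n1 turn) => /(_ k) /andP[? ?] _; rewrite !ltW.
Qed.

Lemma std_circle_polygon r theta : 0 < r < 1 -> one_turn theta ->
  spherical_cyclic_polygon (fun i => std_circle r (theta i)).
Proof.
move=> r01 [incr wrap]; case/andP: (r01) => r0 r1; split.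
  have sep (i j : 'I_n) : (i < j)%N -> std_circle r (theta j) <> std_circle r (theta i).
    move=> ij eq_pt; have := incr _ _ ij; have := wrap i j => ? ?.
    have sin_gap : 0 < sin ((theta j - theta i) / 2).
      by apply: sin_gt0_pi; apply/andP; split; lra.
    have r01' : 0 <= r <= 1 by rewrite !ltW.
    have := congr1 (dot3 (std_circle r (theta j))) eq_pt.
    rewrite !dot3_std_circle // subrr mul0r sin0 mulr0 expr0n mul0rn => eq_dot.
    have : 0 < (r * sin ((theta j - theta i) / 2)) ^+ 2 by rewrite exprn_gt0 // mulr_gt0.
    by move: eq_dot; lra.
  move=> i j eq_pt; apply: val_inj.
  by case: (ltngtP i j) => // [/sep|/sep]; [move/(_ (esym eq_pt))|move/(_ eq_pt)].
have [v [m [e1 [e2 [c [v0 c0 [e11 e22 e12] paramE rangeC]]]]]] := std_circle_range r01.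
exists (@sphere2 R `&` affine_plane v c); split; first by exists v, c.
exists m, r, e1, e2, theta; split=> // i; by rewrite paramE.
Qed.
End Polygons.

(** * Existence and uniqueness of polygons with given sides *)

Theorem theorem2 (R : realType) (n : nat) (l : 'I_n -> R)
    (hn : (3 <= n)%N) (hl : forall k : 'I_n, 0 < l k) :
  ((exists p : 'I_n -> 'rV[R]_3,
      spherical_cyclic_polygon p /\ forall k : 'I_n, side_length p k = l k)
   <->
   ((forall k : 'I_n, l k < \sum_(i < n | i != k) l i) /\
    \sum_(i < n) l i < 2 * pi))
  /\
  ((forall k : 'I_n, l k < \sum_(i < n | i != k) l i) ->
   \sum_(i < n) l i < 2 * pi ->
   forall p q : 'I_n -> 'rV[R]_3,
     spherical_cyclic_polygon p -> (forall k : 'I_n, side_length p k = l k) ->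
     spherical_cyclic_polygon q -> (forall k : 'I_n, side_length q k = l k) ->
     polygon_congruent p q).
Proof.
have card_n : (2 < #|'I_n|)%N by rewrite card_ord.
have n1 : (1 < n)%N by exact: ltnW.
have n0 : (0 < n)%N by exact: ltnW.
split; first split.
- move=> [p [poly_p side_p]].
  have [r [A [theta [r01 oA turn pE sideE]]]] := polygon_std n1 poly_p.
  have splits := half_gap_splits_pi n1 turn.
  have lE k : l k = 2 * half_side r (half_gap theta k) by rewrite -side_p.
  rewrite (eq_bigr _ (fun i _ => lE i)) -mulr_sumr ltr_pM2l //.
  split=> [k|]; last exact: half_side_sum_lt_pi.
  rewrite (eq_bigr _ (fun i _ => lE i)) lE -mulr_sumr ltr_pM2l //.
  exact: half_side_lt_sum.
- move=> [tri sum_l].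
  have [|k||r [a [r01 splits halfE]]] :=
    @half_angles_exist R 'I_n card_n (fun k => l k / 2).
  + by move=> i; rewrite divr_gt0.
  + by rewrite -mulr_suml ltr_pM2r.
  + by rewrite -mulr_suml ltr_pdivrMr // mulrC.
  have turn := partial_turn_one_turn splits.
  exists (fun i => std_circle r (partial_turn a i)); split.
    exact: std_circle_polygon.
  move=> k; case/andP: (r01) => r0 r1.
  have [a0 _] := splits; have /andP[ak0 akpi] := a0 k.
  have pE i : std_circle r (partial_turn a i) = std_circle r (partial_turn a i) *m 1%:M.
    by rewrite mulmx1.
  rewrite (side_length_std _ _ _ pE) ?half_gap_partial_turn ?ltW //.
    by rewrite halfE mulrC divfK.
  by rewrite /orthogonal_mx trmx1 mulmx1.
move=> _ _ p q poly_p side_p poly_q side_q.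
have [r [A [theta [r01 oA turn pE sideE]]]] := polygon_std n1 poly_p.
have [r' [A' [theta' [r'01 oA' turn' qE sideE']]]] := polygon_std n1 poly_q.
case/andP: (r01) => r0 r1; case/andP: (r'01) => r'0 r'1.
have [|eq_r eq_gap] := half_angles_unique card_n r0 r'0
    (half_gap_splits_pi n1 turn) (half_gap_splits_pi n1 turn').
  move=> k; rewrite -!sin_half_side ?ltW //; congr sin.
  have := sideE' k; rewrite side_q -side_p sideE => /mulfI; apply.
  by rewrite pnatr_eq0.
have [d theta'E] := half_gap_eq_shift n0 eq_gap.
(* A^T moves p to the standard circle, the rotation aligns the vertices, and
   A' moves them to q. *)
exists (fun x => x *m (A^T *m rotation d *m A')); split.
  apply: orthogonal_sphere_isometry; apply: orthogonal_mxM => //.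
  by apply: orthogonal_mxM; [exact: orthogonal_mxT|exact: rotation_orthogonal].
move=> k; rewrite qE pE !mulmxA -(mulmxA _ A) oA mulmx1 std_circle_rotation.
by rewrite eq_r theta'E.
Qed.
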